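(* Let $n\geq 4$ and $r$ be integers satisfying $-1\leq r\leq n-2$. Then $$c_{n,r}\leq\frac{J_n(r+2)}{J_n(r)},$$ where $$c_{n,r}=\frac{(n-r)^2}{(n+r+2)^2}\cdot\frac{(4n-7r-8)(4n+3r+6)}{(4n+7r+6)(4n-3r)}.$$ Moreover, the equality $c_{n,r}=\frac{J_n(r+2)}{J_n(r)}$ holds if and only if $r=-1$.
   Context: For an integer $n\geq 1$ and $r\in\mathbb{R}$, the Laplace--Pólya integral is $J_n(r)=\frac{1}{\pi}\int_{-\infty}^{\infty}\operatorname{sinc}^n(t)\cos(rt)\,dt$, where $\operatorname{sinc}(x)=\frac{\sin x}{x}$ for $x\neq 0$ and $\operatorname{sinc}(0)=1$. *)

(* Defs.v *)
From Stdlib Require Import Reals ZArith.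
From Coquelicot Require Import Coquelicot.
Open Scope R_scope.

Definition sinc (x : R) : R :=
  if Req_EM_T x 0 then 1 else sin x / x.

(** The integral is an improper Riemann integral, the two endpoints tending to
    infinity independently: for [n = 1] it converges only conditionally. *)
Definition laplace_polya (n : nat) (r : R) : R :=
  / PI * RInt_gen (fun t => sinc t ^ n * cos (r * t))
           (Rbar_locally m_infty) (Rbar_locally p_infty).

Definition c_bound (n r : R) : R :=
  (n - r) ^ 2 / (n + r + 2) ^ 2 *
  (((4 * n - 7 * r - 8) * (4 * n + 3 * r + 6)) /
   ((4 * n + 7 * r + 6) * (4 * n - 3 * r))).

(* Main.v *)
Require Import Defs.
From Stdlib Require Import Reals ZArith Lra Lia Psatz.
From Coquelicot Require Import Coquelicot.
Open Scope R_scope.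

(** Integrating the derivative of [sinc t ^ n * sin t * cos (r * t)] over the line
    gives
      [2 n J_(n+1) r = (n + 1 + r) J_n (r + 1) + (n + 1 - r) J_n (r - 1)],
    and the Dirichlet integral gives [J_1 r = (sign (1 + r) + sign (1 - r)) / 2], up
    to a positive factor which cancels in the ratios. Hence [J_n r] is positive
    for [|r| < n] and zero for [|r| >= n].
    The bound is proved by induction on [n] from [n = 4]: in the recurrence for
    [J_(n+1) (r + 2)] and [J_(n+1) r], the ratios [J_n (r + 3) / J_n (r + 1)] and
    [J_n (r + 1) / J_n (r - 1)] are bounded below by [c_(n,r+1)] and [c_(n,r-1)],
    which leaves a rational inequality in [n] and [r]. It holds when
    [7 r + 4 < 4 n]; otherwise [c_(n+1,r) <= 0]. For [r = 0] the induction uses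
    [c_(n,-1) = 1 = J_n 1 / J_n (-1)]. *)

(** * Continuity and bounds of [sinc] *)

Lemma sinc_0 : sinc 0 = 1.
Proof. unfold sinc; destruct (Req_EM_T 0 0); lra. Qed.

Lemma sinc_neq0 (x : R) : x <> 0 -> sinc x = sin x / x.
Proof. intros hx; unfold sinc; destruct (Req_EM_T x 0); [easy | reflexivity]. Qed.

Lemma mul_sinc (x : R) : x * sinc x = sin x.
Proof.
destruct (Req_dec x 0) as [-> | hx]; [rewrite sin_0; ring |].
now rewrite sinc_neq0 by easy; field.
Qed.

Lemma sinc_opp (x : R) : sinc (- x) = sinc x.
Proof.
destruct (Req_dec x 0) as [-> | hx]; [now rewrite Ropp_0 |].
rewrite !sinc_neq0 by lra; rewrite sin_neg; field; lra.
Qed.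

Lemma is_derive_sinc_neq0 (x : R) : x <> 0 ->
  is_derive sinc x ((cos x - sinc x) / x).
Proof.
intros hx.
apply (is_derive_ext_loc (fun t => sin t / t)).
  assert (hp : 0 < Rabs x) by now apply Rabs_pos_lt.
  exists (mkposreal _ hp); intros t ht; rewrite sinc_neq0; [easy|].
  intros ->; revert ht; unfold ball; simpl.
  unfold AbsRing_ball, abs, minus, plus, opp; simpl.
  rewrite Rplus_0_l, Rabs_Ropp; lra.
rewrite sinc_neq0 by easy; auto_derive; [easy | field; easy].
Qed.

Lemma continuous_sinc (x : R) : continuous sinc x.
Proof.
destruct (Req_dec x 0) as [-> | hx].
2: now apply (ex_derive_continuous (V := R_NormedModule)); eexists; apply is_derive_sinc_neq0.
(* At 0, continuity is the limit of the difference quotient of [sin]. *)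
apply continuity_pt_filterlim; intros eps heps.
destruct (derivable_pt_lim_sin_0 eps heps) as [d hd].
exists d; split; [apply cond_pos |]; intros t [[_ ht] hdt].
simpl in *; unfold Rdist in *; rewrite Rminus_0_r in hdt.
rewrite sinc_0, sinc_neq0 by auto.
specialize (hd t (not_eq_sym ht) hdt).
now rewrite Rplus_0_l, sin_0, Rminus_0_r in hd.
Qed.

Lemma continuous_Rmult (f g : R -> R) (x : R) :
  continuous f x -> continuous g x -> continuous (fun t => f t * g t) x.
Proof. exact (continuous_mult f g x). Qed.

Lemma continuous_sinc_pow (n : nat) (x : R) : continuous (fun t => sinc t ^ n) x.
Proof.
induction n as [|n IH]; simpl; [apply continuous_const |].
apply continuous_Rmult; [apply continuous_sinc | exact IH].
Qed.

Lemma continuous_cos_scal (r x : R) : continuous (fun t => cos (r * t)) x.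
Proof. apply (ex_derive_continuous (V := R_NormedModule)); auto_derive; easy. Qed.

Lemma continuous_cmul_sinc_cos (c : R) (n : nat) (r x : R) :
  continuous (fun t => c * (sinc t ^ n * cos (r * t))) x.
Proof.
apply continuous_Rmult; [apply continuous_const |].
apply continuous_Rmult; [apply continuous_sinc_pow | apply continuous_cos_scal].
Qed.

Lemma Rabs_sinc_mul_le (x : R) : Rabs x * Rabs (sinc x) <= 1.
Proof.
rewrite <- Rabs_mult, mul_sinc.
apply Rabs_le, SIN_bound.
Qed.

Lemma Rabs_sinc_le (x : R) : Rabs (sinc x) <= 1.
Proof.
destruct (Req_dec x 0) as [-> | hx]; [rewrite sinc_0, Rabs_R1; lra |].
(* The derivative of [sin] is bounded by 1, hence [|sin x| <= |x|]. *)
assert (H := bounded_variation sin cos 1 0 x).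
rewrite sin_0, !Rminus_0_r, Rmult_1_l in H.
assert (Rabs (sin x) <= Rabs x).
{ apply H; intros t _; split; [apply is_derive_sin |].
  apply Rabs_le, COS_bound. }
assert (0 < Rabs x) by now apply Rabs_pos_lt.
rewrite sinc_neq0 by easy; rewrite Rabs_div by easy.
apply Rle_div_l; lra.
Qed.

(** * The recurrence in [n] by integration by parts *)

Lemma is_derive_mul_id_0 (w : R -> R) : continuous w 0 ->
  is_derive (fun t => t * w t) 0 (w 0).
Proof.
intros hw; apply is_derive_Reals; intros eps heps.
apply continuity_pt_filterlim in hw.
destruct (hw eps heps) as [d [hd H]].
exists (mkposreal d hd); intros h h0 hh; simpl in hh.
replace ((_ - _) / h) with (w (0 + h)) by (rewrite Rplus_0_l; field; easy).
rewrite Rplus_0_l; apply H; split; [split; [exact I | auto] |].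
now simpl; unfold Rdist; rewrite Rminus_0_r.
Qed.

(* Boundary term of the integration by parts behind the recurrence in [n]. *)
Definition boundary (n : nat) (r t : R) : R := sinc t ^ n * sin t * cos (r * t).

(** Off 0, [x sinc' x = cos x - sinc x] and [sin x / x = sinc x]; this leaves the terms [(n+1) cos x
    cos (r x) - r sin x sin (r x)], which the addition formulas regroup into the two shifted
    cosines. *)
Lemma is_derive_boundary (n : nat) (r x : R) :
  is_derive (boundary n r) x
    (- INR n * (sinc x ^ S n * cos (r * x))
     + (INR n + 1 + r) / 2 * (sinc x ^ n * cos ((r + 1) * x))
     + (INR n + 1 - r) / 2 * (sinc x ^ n * cos ((r - 1) * x))).
Proof.
replace ((r + 1) * x) with (r * x + x) by ring.
replace ((r - 1) * x) with (r * x - x) by ring.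
rewrite cos_plus, cos_minus.
destruct (Req_dec x 0) as [-> | hx].
(* Pulling out a factor [t] makes the difference quotient at 0 a continuous function, so [sinc]
   itself is not differentiated at 0. *)
- apply (is_derive_ext (fun t => t * (sinc t ^ S n * cos (r * t)))).
    intros t; unfold boundary; simpl; rewrite <- (mul_sinc t); ring.
  assert (H : continuous (fun t => sinc t ^ S n * cos (r * t)) 0)
    by (apply continuous_Rmult; [apply continuous_sinc_pow | apply continuous_cos_scal]).
  generalize (is_derive_mul_id_0 _ H); cbn beta.
  rewrite sinc_0, !Rmult_0_r, sin_0, cos_0, !pow1; intros H1.
  match goal with |- is_derive _ _ ?a => replace a with (1 * 1) by field end.
  exact H1.
- assert (H := is_derive_sinc_neq0 x hx).
  assert (H1 : is_derive (fun t => sinc t ^ n) x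
     (INR n * ((cos x - sinc x) / x) * sinc x ^ pred n)) by now apply is_derive_pow.
  unfold boundary; evar_last.
    apply (is_derive_mult (fun t => sinc t ^ n * sin t) (fun t => cos (r * t)));
      [|auto_derive; [easy | reflexivity] | exact Rmult_comm].
    apply (is_derive_mult (fun t => sinc t ^ n) sin);
      [exact H1 | apply is_derive_sin | exact Rmult_comm].
  unfold plus, mult; simpl.
  (* The power rule involves [pred n], which truncates at [n = 0]. *)
  destruct n as [|n]; [simpl; field |].
    easy.
  rewrite S_INR; simpl; rewrite (sinc_neq0 x) by easy.
  field; easy.
Qed.

(** The endpoints run through a product filter, so the limit of [F b - F a] splits into two
    one-variable limits. *)
Lemma is_RInt_gen_primitive (f F : R -> R) (l m : R) :
  (forall a b, is_RInt f a b (F b - F a)) ->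
  is_lim F m_infty l -> is_lim F p_infty m ->
  is_RInt_gen f (Rbar_locally m_infty) (Rbar_locally p_infty) (m - l).
Proof.
intros HF Hl Hm P HP.
assert (H : filterlim (fun ab => F (snd ab) - F (fst ab))
   (filter_prod (Rbar_locally m_infty) (Rbar_locally p_infty)) (locally (m - l))).
{ apply (filterlim_comp_2 (fun ab : R * R => F (snd ab)) (fun ab => - F (fst ab)) Rplus
    (G := locally m) (H := locally (- l))).
  - eapply filterlim_comp; [apply filterlim_snd | exact Hm].
  - eapply filterlim_comp; [|apply (filterlim_opp l)].
    eapply filterlim_comp; [apply filterlim_fst | exact Hl].
  - exact (filterlim_plus m (- l)). }
specialize (H P HP).
unfold filtermap in H; unfold filtermapi.
eapply filter_imp; [|exact H].
intros ab Hab; eexists; split; [apply HF | exact Hab].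
Qed.

Lemma is_lim_inv_abs (x : Rbar) : x = p_infty \/ x = m_infty ->
  is_lim (fun t => / Rabs t) x 0.
Proof.
intros [-> | ->].
- replace (Finite 0) with (Rbar_inv p_infty) by reflexivity.
  apply is_lim_inv; [|easy].
  exact (is_lim_Rabs (fun t => t) p_infty p_infty (is_lim_id _)).
- replace (Finite 0) with (Rbar_inv p_infty) by reflexivity.
  apply is_lim_inv; [|easy].
  exact (is_lim_Rabs (fun t => t) m_infty m_infty (is_lim_id _)).
Qed.

Lemma is_lim_abs_le (f g : R -> R) (x : Rbar) :
  Rbar_locally' x (fun t => Rabs (f t) <= g t) -> is_lim g x 0 -> is_lim f x 0.
Proof.
intros H Hg.
apply (is_lim_le_le_loc (fun t => - g t) g); [| | exact Hg].
- revert H; apply filter_imp; intros t ht; apply Rabs_le_between in ht; exact ht.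
- replace (Finite 0) with (Rbar_opp 0) by (simpl; f_equal; ring).
  now apply is_lim_opp.
Qed.

(** Since [n >= 1] there is a factor [sinc t], bounded by [1 / |t|]; all other factors are bounded
    by 1. *)
Lemma is_lim_boundary (n : nat) (r : R) (x : Rbar) :
  (1 <= n)%nat -> x = p_infty \/ x = m_infty -> is_lim (boundary n r) x 0.
Proof.
intros hn hx.
apply (is_lim_abs_le _ (fun t => / Rabs t)); [|now apply is_lim_inv_abs].
assert (H : forall t, t <> 0 -> Rabs (boundary n r t) <= / Rabs t).
{ intros t ht.
  assert (0 < Rabs t) by now apply Rabs_pos_lt.
  unfold boundary; rewrite !Rabs_mult, <- RPow_abs.
  destruct n as [|n]; [lia |]; simpl.
  assert (h1 := Rabs_sinc_mul_le t).
  assert (h2 : Rabs (sinc t) ^ n <= 1)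
    by (rewrite <- (pow1 n); apply pow_incr; split; [apply Rabs_pos | apply Rabs_sinc_le]).
  assert (h3 : Rabs (sin t) <= 1) by apply Rabs_le, SIN_bound.
  assert (h4 : Rabs (cos (r * t)) <= 1) by apply Rabs_le, COS_bound.
  assert (h0 : Rabs (sinc t) <= / Rabs t).
  { apply (Rmult_le_reg_l (Rabs t)); [easy |]; rewrite Rinv_r by lra; exact h1. }
  assert (h5 := Rabs_pos (sinc t)); assert (h6 := Rabs_pos (sin t)).
  assert (h7 := Rabs_pos (cos (r * t))); assert (h8 : 0 <= Rabs (sinc t) ^ n) by now apply pow_le.
  rewrite <- (Rmult_1_r (/ Rabs t)).
  apply Rmult_le_compat; [repeat apply Rmult_le_pos; easy | easy | | easy].
  rewrite <- (Rmult_1_r (/ Rabs t)).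
  apply Rmult_le_compat; [apply Rmult_le_pos; easy | easy | | easy].
  rewrite <- (Rmult_1_r (/ Rabs t)).
  apply Rmult_le_compat; easy. }
destruct hx as [-> | ->]; exists 0; intros t ht; apply H; lra.
Qed.

(** The derivative [g] of the boundary term has integral 0. Solving its formula for the power [S n]
    gives a combination of integrable functions, so convergence comes together with the value. *)
Lemma is_RInt_gen_sinc_pow_S (n : nat) (r lp lm : R) : (1 <= n)%nat ->
  is_RInt_gen (fun t => sinc t ^ n * cos ((r + 1) * t))
    (Rbar_locally m_infty) (Rbar_locally p_infty) lp ->
  is_RInt_gen (fun t => sinc t ^ n * cos ((r - 1) * t))
    (Rbar_locally m_infty) (Rbar_locally p_infty) lm ->
  is_RInt_gen (fun t => sinc t ^ S n * cos (r * t))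
    (Rbar_locally m_infty) (Rbar_locally p_infty)
    (((INR n + 1 + r) * lp + (INR n + 1 - r) * lm) / (2 * INR n)).
Proof.
intros hn Hp Hm.
assert (hN : 0 < INR n) by (apply lt_0_INR; lia).
set (g := fun x => - INR n * (sinc x ^ S n * cos (r * x))
     + (INR n + 1 + r) / 2 * (sinc x ^ n * cos ((r + 1) * x))
     + (INR n + 1 - r) / 2 * (sinc x ^ n * cos ((r - 1) * x))).
assert (Hg : is_RInt_gen g (Rbar_locally m_infty) (Rbar_locally p_infty) (0 - 0)).
{ apply (is_RInt_gen_primitive g (boundary n r)); try (apply is_lim_boundary; auto).
  intros a b; apply (is_RInt_derive (boundary n r) g).
    intros x _; apply is_derive_boundary.
  intros x _; unfold g.
  apply @continuous_plus; [apply @continuous_plus |]; apply continuous_cmul_sinc_cos. }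
evar_last.
eapply (is_RInt_gen_ext (fun x =>
   plus (scal ((INR n + 1 + r) / (2 * INR n)) (sinc x ^ n * cos ((r + 1) * x)))
   (plus (scal ((INR n + 1 - r) / (2 * INR n)) (sinc x ^ n * cos ((r - 1) * x)))
     (scal (- / INR n) (g x))))).
- apply filter_forall; intros ab x _.
  unfold plus, scal, g; simpl; unfold mult; simpl; field; lra.
- apply @is_RInt_gen_plus; [apply filter_filter .. | |apply @is_RInt_gen_plus];
    [| apply filter_filter .. | |]; apply @is_RInt_gen_scal; try apply filter_filter; eassumption.
- unfold plus, scal; simpl; unfold mult; simpl; field; lra.
Qed.

(** * The Dirichlet integral and the case [n = 1] *)

Lemma is_lim_mul_p_infty (f : R -> R) (a l : R) : 0 < a ->
  is_lim f p_infty l -> is_lim (fun x => f (a * x)) p_infty l.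
Proof.
intros ha H P HP; destruct (H P HP) as [M HM].
exists (M / a); intros x hx; apply HM.
apply Rlt_div_l in hx; lra.
Qed.

Lemma is_lim_m_infty_opp (f : R -> R) (l : R) :
  is_lim (fun x => f (- x)) p_infty l -> is_lim f m_infty l.
Proof.
intros H P HP; destruct (H P HP) as [M HM].
exists (- M); intros x hx; rewrite <- (Ropp_involutive x); apply HM; lra.
Qed.

(** The limit is the supremum; that it bounds [f] is kept to show later that the limit of [Si] is
    positive. *)
Lemma is_lim_increasing_bounded (f : R -> R) (M : R) :
  (forall x y, 0 <= x <= y -> f x <= f y) -> (forall x, 0 <= x -> f x <= M) ->
  exists l : R, is_lim f p_infty l /\ forall x, 0 <= x -> f x <= l.
Proof.
intros Hi Hb.
destruct (completeness (fun y => exists x, 0 <= x /\ y = f x)) as [l [Hu Hl]].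
- exists M; intros y (x & hx & ->); now apply Hb.
- now exists (f 0), 0; split; [lra |].
- assert (Hle : forall x, 0 <= x -> f x <= l) by (intros x hx; apply Hu; now exists x).
  exists l; split; [|exact Hle].
  apply is_lim_spec; intros eps.
  assert (He := cond_pos eps).
  destruct (Classical_Prop.classic (exists x, 0 <= x /\ l - eps < f x)) as [(x & hx & Hx) | Hn].
  + exists x; intros y hy.
    assert (h1 := Hi x y ltac:(lra)); assert (h2 := Hle y ltac:(lra)).
    apply Rabs_lt_between; lra.
  + exfalso.
    enough (l <= l - eps) by lra.
    apply Hl; intros y (x & hx & ->).
    apply Rnot_lt_le; intros h; apply Hn; now exists x.
Qed.

Definition Si (x : R) : R := RInt sinc 0 x.

Lemma is_RInt_sinc (a b : R) : is_RInt sinc a b (RInt sinc a b).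
Proof.
apply (@RInt_correct R_CompleteNormedModule), (@ex_RInt_continuous R_CompleteNormedModule).
intros z _; apply continuous_sinc.
Qed.

Lemma is_derive_Si (x : R) : is_derive Si x (sinc x).
Proof.
apply (is_derive_RInt sinc Si 0); [|apply continuous_sinc].
apply filter_forall; intros y; apply is_RInt_sinc.
Qed.

Lemma is_derive_Si_scal (a x : R) :
  is_derive (fun t => Si (a * t)) x (a * sinc (a * x)).
Proof.
apply (is_derive_comp (V := R_NormedModule) Si (fun t => a * t)).
  apply is_derive_Si.
auto_derive; [easy | ring].
Qed.

Lemma Si_0 : Si 0 = 0.
Proof. apply (@RInt_point R_CompleteNormedModule). Qed.

Lemma Si_opp (x : R) : Si (- x) = - Si x.
Proof.
assert (H : is_RInt sinc (-1 * 0 + 0) (-1 * x + 0) (Si (- x))).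
{ replace (-1 * 0 + 0) with 0 by ring; replace (-1 * x + 0) with (- x) by ring.
  apply is_RInt_sinc. }
apply (is_RInt_comp_lin sinc (-1) 0) in H.
apply (is_RInt_opp (V := R_NormedModule)) in H.
apply (is_RInt_ext (V := R_NormedModule) _ sinc) in H.
- apply (is_RInt_unique (V := R_CompleteNormedModule)) in H.
  unfold opp in H; simpl in H; unfold Si at 2; rewrite H; ring.
- intros t _; unfold opp, scal; simpl; unfold mult; simpl.
  replace (-1 * t + 0) with (- t) by ring; rewrite sinc_opp; ring.
Qed.

Lemma is_RInt_sinc_sqr (x : R) :
  is_RInt (fun t => sinc t ^ 2) 0 x (RInt (fun t => sinc t ^ 2) 0 x).
Proof.
apply (@RInt_correct R_CompleteNormedModule), (@ex_RInt_continuous R_CompleteNormedModule).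
intros z _; apply continuous_sinc_pow.
Qed.

(** The derivative of [sinc t * sin t] is [2 sinc (2 t) - sinc t ^ 2]. This trades the oscillating
    integrand for a nonnegative one, whose integral is monotone in [x]. *)
Lemma Si_double (x : R) :
  Si (2 * x) = boundary 1 0 x + RInt (fun t => sinc t ^ 2) 0 x.
Proof.
assert (H0 : is_RInt sinc (2 * 0 + 0) (2 * x + 0) (Si (2 * x))).
{ replace (2 * 0 + 0) with 0 by ring; rewrite Rplus_0_r; apply is_RInt_sinc. }
apply (is_RInt_comp_lin sinc 2 0) in H0.
assert (H1 : is_RInt (fun t => 2 * sinc (2 * t) - sinc t ^ 2) 0 x (boundary 1 0 x - 0)).
{ replace (boundary 1 0 x - 0) with (minus (boundary 1 0 x) (boundary 1 0 0))
    by (unfold minus, plus, opp, boundary; simpl; rewrite sin_0; ring).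
  apply (is_RInt_ext (fun t => - INR 1 * (sinc t ^ 2 * cos (0 * t))
     + (INR 1 + 1 + 0) / 2 * (sinc t ^ 1 * cos ((0 + 1) * t))
     + (INR 1 + 1 - 0) / 2 * (sinc t ^ 1 * cos ((0 - 1) * t)))).
  - intros t _; rewrite Rmult_0_l, cos_0.
    replace ((0 + 1) * t) with t by ring; replace ((0 - 1) * t) with (- t) by ring.
    rewrite cos_neg.
    replace (sinc (2 * t)) with (sinc t * cos t); [simpl; field |].
    destruct (Req_dec t 0) as [-> | ht]; [rewrite Rmult_0_r, sinc_0, cos_0; ring |].
    rewrite !sinc_neq0, sin_2a by lra; field; easy.
  - apply (is_RInt_derive (boundary 1 0)); intros t _; [apply is_derive_boundary |].
    apply @continuous_plus; [apply @continuous_plus |]; apply continuous_cmul_sinc_cos. }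
assert (H2 := is_RInt_minus _ _ _ _ _ _ H0 H1).
apply (is_RInt_ext (V := R_NormedModule) _ (fun t => sinc t ^ 2)) in H2.
- apply (is_RInt_unique (V := R_CompleteNormedModule)) in H2.
  rewrite H2; unfold minus, plus, opp; simpl; ring.
- intros t _; unfold minus, plus, opp, scal; simpl; unfold mult; simpl.
  rewrite Rplus_0_r; ring.
Qed.

(** From [(1 + t^2) sinc t ^ 2 = sinc t ^ 2 + sin t ^ 2 <= 2], the integrand is at most
    [2 / (1 + t^2)], with primitive [2 atan t]. *)
Lemma RInt_sinc_sqr_le (x : R) : 0 <= x -> RInt (fun t => sinc t ^ 2) 0 x <= PI.
Proof.
intros hx.
assert (Ha : is_RInt (fun t => 2 * / (1 + t ^ 2)) 0 x (2 * atan x - 2 * atan 0)).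
{ apply (is_RInt_derive (fun t => 2 * atan t)); intros t _.
    auto_derive; [easy | unfold Rsqr; field; nra].
  apply (ex_derive_continuous (V := R_NormedModule)); auto_derive; nra. }
apply Rle_trans with (2 * atan x - 2 * atan 0).
- rewrite <- (is_RInt_unique _ _ _ _ Ha).
  apply RInt_le; [easy | eexists; apply is_RInt_sinc_sqr | eexists; exact Ha |].
  intros t _.
  assert (h1 := Rabs_sinc_le t); assert (h2 := Rabs_sinc_mul_le t).
  rewrite <- Rabs_mult in h2.
  apply (Rmult_le_reg_l (1 + t ^ 2)); [nra |].
  replace ((1 + t ^ 2) * (2 * / (1 + t ^ 2))) with 2 by (field; nra).
  apply Rabs_le_between in h1; apply Rabs_le_between in h2; nra.
- rewrite atan_0; generalize (atan_bound x); lra.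
Qed.

Lemma RInt_sinc_sqr_increasing (x y : R) : 0 <= x <= y ->
  RInt (fun t => sinc t ^ 2) 0 x <= RInt (fun t => sinc t ^ 2) 0 y.
Proof.
intros h.
assert (H : ex_RInt (fun t => sinc t ^ 2) x y).
{ apply (@ex_RInt_continuous R_CompleteNormedModule); intros; apply continuous_sinc_pow. }
rewrite <- (RInt_Chasles (fun t => sinc t ^ 2) 0 x y) by
  (try exact H; eexists; apply is_RInt_sinc_sqr).
unfold plus; simpl.
enough (0 <= RInt (fun t => sinc t ^ 2) x y) by (simpl in *; lra).
apply RInt_ge_0; [easy | exact H |].
intros; apply pow2_ge_0.
Qed.

(* [L] is [PI / 2], but only its sign matters for the ratios. *)
Lemma is_lim_Si : exists L : R, 0 < L /\ is_lim Si p_infty L.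
Proof.
destruct (is_lim_increasing_bounded (fun x => RInt (fun t => sinc t ^ 2) 0 x) PI)
  as (L & HL & Hle).
- exact RInt_sinc_sqr_increasing.
- exact RInt_sinc_sqr_le.
- exists L; split.
  + apply Rlt_le_trans with (2 := Hle 1 Rle_0_1).
    apply RInt_gt_0; [lra | | intros; apply continuous_sinc_pow].
    intros t ht; apply pow_lt; rewrite sinc_neq0 by lra.
    apply Rdiv_lt_0_compat; [apply sin_gt_0; generalize PI2_1; lra | lra].
  + apply (is_lim_ext (fun x => Si (2 * (/ 2 * x)))).
      intros x; f_equal; field.
    apply (is_lim_mul_p_infty (fun y => Si (2 * y))); [lra |].
    eapply is_lim_ext; [intros y; symmetry; apply Si_double |].
    replace L with (0 + L) by ring.
    apply is_lim_plus'; [apply is_lim_boundary; auto | exact HL].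
Qed.

Lemma is_lim_Si_scal (L a : R) :
  is_lim Si p_infty L -> is_lim (fun x => Si (a * x)) p_infty (sign a * L).
Proof.
intros HL; destruct (Rtotal_order a 0) as [h | [-> | h]].
- rewrite sign_eq_m1 by easy; replace (-1 * L) with (- L) by ring.
  apply (is_lim_ext (fun x => - Si (- a * x))).
    intros x; rewrite <- Si_opp; f_equal; ring.
  apply (is_lim_opp _ _ L), is_lim_mul_p_infty; [lra | easy].
- rewrite sign_0, Rmult_0_l.
  apply (is_lim_ext (fun _ => 0)); [|apply is_lim_const].
  intros x; now rewrite Rmult_0_l, Si_0.
- rewrite sign_eq_1, Rmult_1_l by easy; now apply is_lim_mul_p_infty.
Qed.

(** From [2 sin x cos (r x) = sin ((1+r) x) + sin ((1-r) x)], the function [F] is a primitive. It is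
    odd, so its limits at the two ends are opposite. *)
Lemma is_RInt_gen_sinc_cos (L r : R) : is_lim Si p_infty L ->
  is_RInt_gen (fun t => sinc t ^ 1 * cos (r * t))
    (Rbar_locally m_infty) (Rbar_locally p_infty) ((sign (1 + r) + sign (1 - r)) * L).
Proof.
intros HL.
set (F := fun x => / 2 * (Si ((1 + r) * x) + Si ((1 - r) * x))).
set (l := / 2 * (sign (1 + r) * L + sign (1 - r) * L)).
replace ((sign (1 + r) + sign (1 - r)) * L) with (l - - l) by (unfold l; field).
assert (HF : is_lim F p_infty l).
{ apply (is_lim_scal_l _ (/ 2) p_infty (sign (1 + r) * L + sign (1 - r) * L)).
  apply is_lim_plus'; now apply is_lim_Si_scal. }
apply (is_RInt_gen_primitive _ F); [| |exact HF].
- intros a b; apply (is_RInt_derive F); intros x _.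
  + unfold F; evar_last.
      exact (is_derive_scal _ x (/ 2) _ (is_derive_plus (V := R_NormedModule) _ _ x _ _
        (is_derive_Si_scal (1 + r) x) (is_derive_Si_scal (1 - r) x))).
    unfold plus; simpl.
    destruct (Req_dec x 0) as [-> | hx].
      rewrite !Rmult_0_r, sinc_0, cos_0; field.
    apply (Rmult_eq_reg_l (2 * x)); [|lra].
    transitivity (sin ((1 + r) * x) + sin ((1 - r) * x)).
      rewrite <- (mul_sinc ((1 + r) * x)), <- (mul_sinc ((1 - r) * x)); field.
    replace ((1 + r) * x) with (x + r * x) by ring.
    replace ((1 - r) * x) with (x - r * x) by ring.
    rewrite sin_plus, sin_minus, <- (mul_sinc x); ring.
  + apply continuous_Rmult; [apply continuous_sinc_pow | apply continuous_cos_scal].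
- apply is_lim_m_infty_opp.
  apply (is_lim_ext (fun x => - F x)); [|exact (is_lim_opp F _ l HF)].
  intros x; unfold F; rewrite <- !Ropp_mult_distr_r, !Si_opp; ring.
Qed.

(** * Convergence, recurrence and sign of the Laplace-Pólya integral *)

Lemma ex_RInt_gen_sinc_pow_cos (n : nat) (r : R) : (1 <= n)%nat ->
  exists l, is_RInt_gen (fun t => sinc t ^ n * cos (r * t))
    (Rbar_locally m_infty) (Rbar_locally p_infty) l.
Proof.
intros hn; revert r; induction hn as [|n hn IH]; intros r.
- destruct is_lim_Si as (L & _ & HL); eexists; exact (is_RInt_gen_sinc_cos L r HL).
- destruct (IH (r + 1)) as [lp Hp]; destruct (IH (r - 1)) as [lm Hm].
  eexists; apply is_RInt_gen_sinc_pow_S; eassumption.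
Qed.

Lemma laplace_polya_eq (n : nat) (r l : R) :
  is_RInt_gen (fun t => sinc t ^ n * cos (r * t))
    (Rbar_locally m_infty) (Rbar_locally p_infty) l ->
  laplace_polya n r = / PI * l.
Proof.
intros H; unfold laplace_polya.
now rewrite (is_RInt_gen_unique (V := R_CompleteNormedModule) _ l H).
Qed.

Lemma laplace_polya_S (n : nat) (r : R) : (1 <= n)%nat ->
  2 * INR n * laplace_polya (S n) r =
    (INR n + 1 + r) * laplace_polya n (r + 1) + (INR n + 1 - r) * laplace_polya n (r - 1).
Proof.
intros hn.
assert (hN : 0 < INR n) by (apply lt_0_INR; lia).
destruct (ex_RInt_gen_sinc_pow_cos n (r + 1) hn) as [lp Hp].
destruct (ex_RInt_gen_sinc_pow_cos n (r - 1) hn) as [lm Hm].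
rewrite (laplace_polya_eq _ _ _ Hp), (laplace_polya_eq _ _ _ Hm).
rewrite (laplace_polya_eq _ _ _ (is_RInt_gen_sinc_pow_S n r lp lm hn Hp Hm)).
field; split; [apply PI_neq0 | lra].
Qed.

Lemma laplace_polya_opp (n : nat) (r : R) : (1 <= n)%nat ->
  laplace_polya n (- r) = laplace_polya n r.
Proof.
intros hn; destruct (ex_RInt_gen_sinc_pow_cos n r hn) as [l Hl].
rewrite (laplace_polya_eq _ _ _ Hl); apply laplace_polya_eq.
eapply is_RInt_gen_ext; [|exact Hl].
apply filter_forall; intros ab x _; cbn beta.
now rewrite <- Ropp_mult_distr_l, cos_neg.
Qed.

Lemma sign_Rabs (x : R) : x * sign x = Rabs x.
Proof.
destruct (Rtotal_order x 0) as [h | [-> | h]].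
- rewrite sign_eq_m1, Rabs_left by easy; ring.
- rewrite Rabs_R0; ring.
- rewrite sign_eq_1, Rabs_pos_eq by lra; ring.
Qed.

(** The recurrence multiplies each sign of the case [n = 1] by its own argument, and
    [x sign x = |x|]. The result is a tent function supported on [[-2, 2]]. *)
Lemma laplace_polya_2 : exists d, 0 < d /\
  forall r, laplace_polya 2 r = d * (Rabs (2 + r) + Rabs (2 - r) - 2 * Rabs r).
Proof.
destruct is_lim_Si as (L & hL & HL).
assert (hp := PI_RGT_0).
exists (L / (2 * PI)); split; [apply Rdiv_lt_0_compat; lra |].
intros r; assert (H := laplace_polya_S 1 r (le_n _)).
rewrite !(laplace_polya_eq _ _ _ (is_RInt_gen_sinc_cos L _ HL)) in H.
replace (1 + (r + 1)) with (2 + r) in H by ring.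
replace (1 - (r + 1)) with (- r) in H by ring.
replace (1 + (r - 1)) with r in H by ring.
replace (1 - (r - 1)) with (2 - r) in H by ring.
rewrite sign_opp in H; simpl in H.
rewrite <- !sign_Rabs.
apply (Rmult_eq_reg_l (2 * 1)); [|lra]; rewrite H; field; lra.
Qed.

(** The induction starts at 2 because [J_1] does not vanish at [|r| = 1], where it takes half of its
    interior value. *)
Lemma laplace_polya_sign (n : nat) : (2 <= n)%nat -> forall r,
  (Rabs r < INR n -> 0 < laplace_polya n r) /\
  (INR n <= Rabs r -> laplace_polya n r = 0).
Proof.
intros hn; induction hn as [|n hn IH]; intros r.
- destruct laplace_polya_2 as (d & hd & H); rewrite H; simpl.
  split; intros h; [apply Rmult_lt_0_compat; [easy |] | apply Rmult_eq_0_compat_l];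
    revert h; unfold Rabs; repeat destruct Rcase_abs; lra.
- assert (hN : 2 <= INR n) by exact (le_INR 2 n hn).
  assert (H := laplace_polya_S n r ltac:(lia)).
  rewrite S_INR.
  destruct (IH (r + 1)) as [p1 z1]; destruct (IH (r - 1)) as [p2 z2].
  split; intros h.
  + apply (Rmult_lt_reg_l (2 * INR n)); [lra |]; rewrite H, Rmult_0_r.
    assert (h1 : 0 <= laplace_polya n (r + 1)).
    { destruct (Rlt_or_le (Rabs (r + 1)) (INR n)) as [k | k];
        [now apply Rlt_le, p1 | rewrite z1 by easy; lra]. }
    assert (h2 : 0 <= laplace_polya n (r - 1)).
    { destruct (Rlt_or_le (Rabs (r - 1)) (INR n)) as [k | k];
        [now apply Rlt_le, p2 | rewrite z2 by easy; lra]. }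
    apply Rabs_lt_between in h.
    (* Of [r + 1] and [r - 1], the one closer to 0 has absolute value below [n] and a positive
       coefficient. *)
    destruct (Rle_or_lt 0 r) as [k | k].
    * apply Rplus_le_lt_0_compat; [apply Rmult_le_pos; lra |].
      apply Rmult_lt_0_compat; [lra | apply p2, Rabs_lt_between; lra].
    * apply Rplus_lt_le_0_compat; [|apply Rmult_le_pos; lra].
      apply Rmult_lt_0_compat; [lra | apply p1, Rabs_lt_between; lra].
  + rewrite z1, z2 in H by (revert h; unfold Rabs; repeat destruct Rcase_abs; lra).
    apply (Rmult_eq_reg_l (2 * INR n)); lra.
Qed.

(** * The rational inequality of the induction step *)

Definition bnum (n r : R) : R :=
  (n - r) ^ 2 * ((4 * n - 7 * r - 8) * (4 * n + 3 * r + 6)).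
Definition bden (n r : R) : R :=
  (n + r + 2) ^ 2 * ((4 * n + 7 * r + 6) * (4 * n - 3 * r)).

(* Here [m = 4 n - 7 r - 5]; once expanded in [m] and [r], all coefficients are
   nonnegative. *)
Lemma step_poly_shifted (m r : R) : 0 <= m -> 0 <= r ->
  0 < (m + 3 * r + 1) * (m + 4) * (m + 10 * r + 8) * (m + 11 * r + 17) *
      (m + 14 * r + 15) * (m + 4 * r + 9) *
      ((m + 3 * r + 1) * (m - 10) * (m + 10 * r + 14) +
       (m + 11 * r + 17) * (m + 14 * r + 18) * (m + 4 * r + 2)) -
      (m + 3 * r + 9) * (m + 1) * (m + 10 * r + 15) * (m + 11 * r + 9) *
      (m + 14 * r + 18) * (m + 4 * r + 2) *
      ((m + 3 * r + 9) * (m + 4) * (m + 10 * r + 8) +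
       (m + 11 * r + 9) * (m + 14 * r + 4) * (m + 4 * r + 8)).
Proof.
intros hm hr; ring_simplify.
apply Rplus_le_lt_0_compat; [|lra].
repeat apply Rplus_le_le_0_compat; repeat apply Rmult_le_pos;
  try apply pow_le; lra.
Qed.

(** The induction step with both neighbouring ratios replaced by their lower bounds and all
    denominators cleared. *)
Lemma step_poly (n r : R) : 0 <= r -> 7 * r + 5 <= 4 * n -> r + 1 < n ->
  bnum (n + 1) r * ((n + 1 + r) * bnum n (r - 1) + (n + 1 - r) * bden n (r - 1))
    * bden n (r + 1)
  < bden (n + 1) r * ((n + 3 + r) * bnum n (r + 1) + (n - 1 - r) * bden n (r + 1))
    * bnum n (r - 1).
Proof.
intros hr hn hrn.
assert (hm : 0 <= 4 * n - 7 * r - 5) by lra.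
apply Rlt_0_minus.
match goal with |- 0 < ?g => replace g with
  (* The square is common to both sides. The 64 compensates for scaling three factors
     [n + r + const] or [n - r + const] by 4 in each product, which makes them integral in [m] and
     [r]. *)
  (((n + r + 3) * (n - r + 1)) ^ 2 / 64 *
  ((4 * n - 4 * r - 4) * (4 * n - 7 * r - 1) * (4 * n + 3 * r + 3) *
   (4 * n + 4 * r + 12) * (4 * n + 7 * r + 10) * (4 * n - 3 * r + 4) *
   ((4 * n - 4 * r - 4) * (4 * n - 7 * r - 15) * (4 * n + 3 * r + 9) +
    (4 * n + 4 * r + 12) * (4 * n + 7 * r + 13) * (4 * n - 3 * r - 3)) -
   (4 * n - 4 * r + 4) * (4 * n - 7 * r - 4) * (4 * n + 3 * r + 10) *
   (4 * n + 4 * r + 4) * (4 * n + 7 * r + 13) * (4 * n - 3 * r - 3) *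
   ((4 * n - 4 * r + 4) * (4 * n - 7 * r - 1) * (4 * n + 3 * r + 3) +
    (4 * n + 4 * r + 4) * (4 * n + 7 * r - 1) * (4 * n - 3 * r + 3)))) end.
2: unfold bnum, bden; field.
apply Rmult_lt_0_compat.
  apply Rdiv_lt_0_compat; [apply pow_lt; nra | lra].
generalize (step_poly_shifted _ _ hm hr).
match goal with |- 0 < ?a -> 0 < ?b => replace b with a by ring end.
easy.
Qed.

Lemma bden_pos (n r : R) : 4 <= n -> -1 <= r <= n - 2 -> 0 < bden n r.
Proof.
intros hn hr; unfold bden.
apply Rmult_lt_0_compat; [apply pow_lt; lra | apply Rmult_lt_0_compat; lra].
Qed.

Lemma bnum_pos (n r : R) : -1 <= r < n -> 7 * r + 8 < 4 * n -> 0 < bnum n r.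
Proof.
intros hr hn; unfold bnum.
apply Rmult_lt_0_compat; [apply pow_lt; lra | apply Rmult_lt_0_compat; lra].
Qed.

Lemma bnum_nonpos (n r : R) : 0 <= r -> 0 <= n -> 4 * n <= 7 * r + 8 -> bnum n r <= 0.
Proof.
intros hr h0 hn; unfold bnum.
assert (h := pow2_ge_0 (n - r)).
assert ((4 * n - 7 * r - 8) * (4 * n + 3 * r + 6) <= 0) by nra.
nra.
Qed.

Lemma c_bound_eq (n r : R) : c_bound n r = bnum n r / bden n r.
Proof.
unfold c_bound, bnum, bden, Rdiv; rewrite !Rinv_mult; ring.
Qed.

(** Here [x], [y], [z] stand for [J_n] at [r - 1], [r + 1], [r + 3]. The hypotheses bound [x] above
    and [z] below by multiples of [y], which reduces the claim to [step_poly] times [y]. *)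
Lemma ratio_step (n r x y z : R) : 4 <= n -> 0 <= r -> 7 * r + 5 <= 4 * n ->
  r + 1 <= n - 2 -> 0 < y ->
  bnum n (r - 1) * x <= bden n (r - 1) * y ->
  bnum n (r + 1) * y <= bden n (r + 1) * z ->
  bnum (n + 1) r * ((n + 1 + r) * y + (n + 1 - r) * x)
  < bden (n + 1) r * ((n + 3 + r) * z + (n - 1 - r) * y).
Proof.
intros hn hr hnr hrn hy hx hz.
assert (hC : 0 < bnum n (r - 1)) by (apply bnum_pos; lra).
assert (hB : 0 < bden n (r + 1)) by (apply bden_pos; lra).
assert (hG : 0 < bden (n + 1) r) by (apply bden_pos; lra).
assert (hE : 0 < bnum (n + 1) r) by (apply bnum_pos; lra).
assert (hp := step_poly n r hr hnr ltac:(lra)).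
revert hC hB hG hE hp hx hz.
generalize (bnum n (r - 1)) (bden n (r - 1)) (bnum n (r + 1)) (bden n (r + 1))
  (bnum (n + 1) r) (bden (n + 1) r).
intros C D A B E G hC hB hG hE hp hx hz.
apply (Rmult_lt_reg_r (B * C)); [now apply Rmult_lt_0_compat |].
apply Rle_lt_trans with (E * ((n + 1 + r) * C + (n + 1 - r) * D) * B * y).
- apply Rminus_le_0.
  replace (_ - _) with (E * B * (n + 1 - r) * (D * y - C * x)) by ring.
  repeat apply Rmult_le_pos; lra.
- apply Rlt_le_trans with (G * ((n + 3 + r) * A + (n - 1 - r) * B) * C * y).
    now apply Rmult_lt_compat_r.
  apply Rminus_le_0.
  replace (_ - _) with (G * C * (n + 3 + r) * (B * z - A * y)) by ring.
  repeat apply Rmult_le_pos; lra.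
Qed.

(** * Induction on [n] for the ratio bound *)

Lemma laplace_polya_S_shift (n : nat) (r : R) : (1 <= n)%nat ->
  2 * INR n * laplace_polya (S n) (r + 2) =
    (INR n + 3 + r) * laplace_polya n (r + 1 + 2) + (INR n - 1 - r) * laplace_polya n (r + 1).
Proof.
intros hn; rewrite laplace_polya_S by easy.
replace (r + 2 + 1) with (r + 1 + 2) by ring.
replace (r + 2 - 1) with (r + 1) by ring; ring.
Qed.

(** The left side is at most 0 and the right side at least 0. The disjunction makes one of them
    strict: at [r = n - 2] the right side is 0, so [bnum] must be negative. *)
Lemma ratio_of_nonpos (n : nat) (r : R) : (2 <= n)%nat -> 0 <= r <= INR n - 2 ->
  bnum (INR n) r <= 0 -> (bnum (INR n) r < 0 \/ r < INR n - 2) ->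
  0 < bden (INR n) r ->
  bnum (INR n) r * laplace_polya n r < bden (INR n) r * laplace_polya n (r + 2).
Proof.
intros hn hr hA hs hB.
assert (h1 : 0 < laplace_polya n r)
  by (apply laplace_polya_sign; [easy |]; rewrite Rabs_pos_eq; lra).
destruct (laplace_polya_sign n hn (r + 2)) as [hp hz].
rewrite Rabs_pos_eq in hp, hz by lra.
destruct (Rlt_or_le (r + 2) (INR n)) as [k | k].
- apply hp in k.
  apply Rle_lt_trans with 0; [nra | now apply Rmult_lt_0_compat].
- rewrite hz by easy; destruct hs; [nra | lra].
Qed.

(** Two uses of the recurrence reduce [J_4] to the tent function [J_2]; each case is then a
    numerical comparison of multiples of [d]. *)
Lemma ratio_4 (r : Z) : (0 <= r <= 2)%Z ->
  bnum (INR 4) (IZR r) * laplace_polya 4 (IZR r)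
  < bden (INR 4) (IZR r) * laplace_polya 4 (IZR r + 2).
Proof.
intros hr.
destruct laplace_polya_2 as (d & hd & H2).
assert (H3 := fun r => laplace_polya_S 2 r ltac:(lia)).
assert (H4 := fun r => laplace_polya_S 3 r ltac:(lia)).
simpl INR in *.
assert (E3 : forall r, laplace_polya 3 r =
  / 4 * ((3 + r) * laplace_polya 2 (r + 1) + (3 - r) * laplace_polya 2 (r - 1))).
{ intros s; generalize (H3 s); lra. }
assert (E4 : forall r, laplace_polya 4 r =
  / 6 * ((4 + r) * laplace_polya 3 (r + 1) + (4 - r) * laplace_polya 3 (r - 1))).
{ intros s; generalize (H4 s); lra. }
assert (hr' : r = 0%Z \/ r = 1%Z \/ r = 2%Z) by lia.
rewrite !E4, !E3, !H2; unfold bnum, bden.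
destruct hr' as [-> | [-> | ->]];
  repeat match goal with |- context [Rabs ?a] =>
    first [rewrite (Rabs_pos_eq a) by lra | rewrite (Rabs_left1 a) by lra] end;
  lra.
Qed.

Lemma ratio_lt (n : nat) : (4 <= n)%nat -> forall r : Z, (0 <= r <= Z.of_nat n - 2)%Z ->
  bnum (INR n) (IZR r) * laplace_polya n (IZR r)
  < bden (INR n) (IZR r) * laplace_polya n (IZR r + 2).
Proof.
intros hn; induction hn as [|n hn IH]; intros r hr; [now apply ratio_4; lia |].
assert (hN : 4 <= INR n) by (replace 4 with (INR 4) by (simpl; ring); now apply le_INR).
assert (hr0 : 0 <= IZR r) by (apply IZR_le; lia).
assert (hr1 : IZR r <= INR n - 1).
{ rewrite INR_IZR_INZ, <- minus_IZR; apply IZR_le; lia. }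
(* The threshold is the sign of [4 (n+1) - 7 r - 8], the factor of [bnum (n+1) r] that can be
   negative. *)
destruct (Z_lt_le_dec (7 * r + 4) (4 * Z.of_nat n)) as [h | h].
- assert (h' : 7 * IZR r + 5 <= 4 * INR n).
  { rewrite INR_IZR_INZ, <- !mult_IZR, <- plus_IZR; apply IZR_le; lia. }
  (* Integrality of [r] matters: for [n = 4] and [n = 5] the real bound [(4 n - 5) / 7] exceeds
     [n - 3]. *)
  assert (hr2 : IZR r + 1 <= INR n - 2).
  { rewrite INR_IZR_INZ, <- minus_IZR, <- plus_IZR; apply IZR_le; lia. }
  assert (hz := IH (r + 1)%Z ltac:(lia)); rewrite plus_IZR in hz.
  assert (hx : bnum (INR n) (IZR r - 1) * laplace_polya n (IZR r - 1)
               <= bden (INR n) (IZR r - 1) * laplace_polya n (IZR r + 1)).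
  { destruct (Z.eq_dec r 0) as [-> | hr3].
    - replace (0 - 1) with (- (1)) by ring; rewrite laplace_polya_opp, Rplus_0_l by lia.
      apply Req_le; unfold bnum, bden; ring.
    - assert (hx := IH (r - 1)%Z ltac:(lia)); rewrite minus_IZR in hx.
      replace (IZR r + 1) with (IZR r - 1 + 2) by ring; lra. }
  assert (hy : 0 < laplace_polya n (IZR r + 1))
    by (apply laplace_polya_sign; [lia |]; rewrite Rabs_pos_eq; lra).
  apply (Rmult_lt_reg_l (2 * INR n)); [lra |].
  rewrite <- !Rmult_assoc, !(Rmult_comm (2 * INR n)), !Rmult_assoc.
  rewrite <- !(Rmult_assoc 2).
  rewrite laplace_polya_S, laplace_polya_S_shift, S_INR by lia.
  apply ratio_step; try easy; lra.
- assert (h' : 4 * INR n <= 7 * IZR r + 4).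
  { rewrite INR_IZR_INZ, <- !mult_IZR, <- plus_IZR; apply IZR_le; lia. }
  assert (hB : 0 < bden (INR (S n)) (IZR r)) by (apply bden_pos; rewrite S_INR; lra).
  assert (hA : bnum (INR (S n)) (IZR r) <= 0) by (apply bnum_nonpos; rewrite ?S_INR; lra).
  apply ratio_of_nonpos; rewrite ?S_INR in *; try easy; try lia; try lra.
  (* At the top value [r = n - 1], [bnum (n+1) r] equals [-84 (n^2 - 1)], which is negative. *)
  destruct (Rlt_or_le (IZR r) (INR n - 1)) as [k | k]; [right; lra | left].
  replace (IZR r) with (INR n - 1) by lra.
  unfold bnum; ring_simplify; nra.
Qed.

Theorem theorem1p2 (n : nat) (r : Z)
  (hn : (4 <= n)%nat) (hr : (-1 <= r <= Z.of_nat n - 2)%Z) :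
  c_bound (INR n) (IZR r)
    <= laplace_polya n (IZR r + 2) / laplace_polya n (IZR r)
  /\ (c_bound (INR n) (IZR r)
        = laplace_polya n (IZR r + 2) / laplace_polya n (IZR r)
      <-> r = (-1)%Z).
Proof.
assert (hN : 4 <= INR n) by (replace 4 with (INR 4) by (simpl; ring); now apply le_INR).
assert (hr0 : -1 <= IZR r <= INR n - 2).
{ rewrite INR_IZR_INZ, <- minus_IZR; split; apply IZR_le; lia. }
assert (hB : 0 < bden (INR n) (IZR r)) by now apply bden_pos.
assert (hJ : 0 < laplace_polya n (IZR r))
  by (apply laplace_polya_sign; [lia |]; apply Rabs_lt_between; lra).
rewrite c_bound_eq.
destruct (Z.eq_dec r (-1)) as [-> | hr1].
- enough (H : bnum (INR n) (-1) / bden (INR n) (-1)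
    = laplace_polya n (-1 + 2) / laplace_polya n (-1))
    by (rewrite H; split; [apply Rle_refl | easy]).
  (* At [r = -1] both ratios are 1, the second by evenness of [J_n]. *)
  replace (-1 + 2) with (- (-1)) by ring; rewrite laplace_polya_opp by lia.
  replace (bnum (INR n) (-1)) with (bden (INR n) (-1)) by (unfold bnum, bden; ring).
  field; lra.
- assert (H := ratio_lt n hn r ltac:(lia)).
  enough (bnum (INR n) (IZR r) / bden (INR n) (IZR r)
    < laplace_polya n (IZR r + 2) / laplace_polya n (IZR r))
    by (split; [lra | split; [lra | easy]]).
  apply Rlt_div_l; [easy |].
  apply (Rmult_lt_reg_r (laplace_polya n (IZR r))); [easy |].
  replace (_ / _ * _ * _) with (bden (INR n) (IZR r) * laplace_polya n (IZR r + 2)) by (field; lra).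
  easy.
Qed.
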